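(* Let $\Omega\subset\mathbb{R}^n$ be a convex domain and $\phi:\overline\Omega\to\mathbb{R}$ a convex function satisfying the structural conditions (H) with constants $\rho,\lambda,\Lambda>0$, and let $\theta_*>1$ be the engulfing constant. Define $d:\overline\Omega\times\overline\Omega\to[0,\infty)$ by $$d(x,y):=\inf\big\{r>0:\ x\in S_\phi(y,r)\ \text{and}\ y\in S_\phi(x,r)\big\}.$$ Then (i) $d(x,y)=d(y,x)$ for all $x,y\in\overline\Omega$; (ii) $d(x,y)=0$ if and only if $x=y$; (iii) $d(x,y)\le\theta_*^2\,[d(x,z)+d(z,y)]$ for all $x,y,z\in\overline\Omega$. In addition, with $B_d(x,r):=\{y\in\overline\Omega:\ d(x,y)<r\}$, $$S_\phi\Big(x,\frac{r}{2\theta_*^2}\Big)\subset B_d(x,r)\subset S_\phi(x,r)\qquad\text{for all }x\in\overline\Omega\text{ and }r>0.$$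
   Context: Structural conditions (H) with constants $\rho,\lambda,\Lambda>0$: (1) $\Omega\subset B_{1/\rho}$ (the ball of radius $1/\rho$ centered at the origin), and for every $x_0\in\partial\Omega$ there is an open ball of radius $\rho$ contained in $\Omega$ and tangent to $\partial\Omega$ at $x_0$; (2) $\phi\in C^{0,1}(\overline\Omega)\cap C^2(\Omega)$ is convex and $\det D^2\phi=g$ in $\Omega$ with $0<\lambda\le g\le\Lambda$; (3) $\rho|x-x_0|^2\le\phi(x)-\phi(x_0)-\nabla\phi(x_0)\cdot(x-x_0)\le\rho^{-1}|x-x_0|^2$ for all $x,x_0\in\partial\Omega$. At boundary points, $\nabla\phi(x_0)$ denotes the value of the continuous extension of $\nabla\phi$ to $\overline\Omega$. The section of $\phi$ centered at $x\in\overline\Omega$ with height $h>0$ is $S_\phi(x,h):=\{y\in\overline\Omega:\ \phi(y)<\phi(x)+\nabla\phi(x)\cdot(y-x)+h\}$. The engulfing constant $\theta_*>1$ is a fixed constant depending only on $\rho,\lambda,\Lambda,n$ such that for every $\Omega,\phi$ satisfying (H) with constants $\rho,\lambda,\Lambda$, all $x\in\overline\Omega$, $t>0$ and $y\in S_\phi(x,t)$, one has $S_\phi(x,t)\subset S_\phi(y,\theta_*t)$ (such a constant exists). *)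

(* Defs.v *)
From mathcomp Require Import all_boot all_order all_algebra.
From mathcomp Require Import all_classical all_reals all_analysis.

Set Implicit Arguments.
Unset Strict Implicit.
Unset Printing Implicit Defensive.

Import Order.TTheory GRing.Theory Num.Theory.
Import numFieldTopology.Exports numFieldNormedType.Exports.

Local Open Scope classical_set_scope.
Local Open Scope ring_scope.

Section Euclidean.
Context {R : realType} {n : nat}.
Implicit Types (x y : 'rV[R]_n) (phi : 'rV[R]_n -> R) (Omega : set 'rV[R]_n).

(* The library norm on 'rV[R]_n is the sup norm. It gives the same topology and
   the same Lipschitz functions as the Euclidean norm, but the balls and the
   squared distances below have to be Euclidean. *)
Definition dotp x y : R := \sum_(i < n) x 0 i * y 0 i.

Definition enorm x : R := Num.sqrt (dotp x x).

Definition eball x (r : R) : set 'rV[R]_n := [set y | enorm (y - x) < r].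

Definition frontier (A : set 'rV[R]_n) : set 'rV[R]_n := closure A `\` A°.

Definition partial (i : 'I_n) phi : 'rV[R]_n -> R :=
  fun x => 'D_(delta_mx 0 i) phi x.

Definition grad phi x : 'rV[R]_n := \row_i partial i phi x.

Definition hessian phi x : 'M[R]_n :=
  \matrix_(i, j) partial j (partial i phi) x.

Definition C2_on Omega phi : Prop :=
  {within Omega, continuous phi} /\
  forall i : 'I_n,
    [/\ forall x, Omega x -> derivable phi x (delta_mx 0 i),
        {within Omega, continuous (partial i phi)} &
        forall j : 'I_n,
          (forall x, Omega x -> derivable (partial i phi) x (delta_mx 0 j)) /\
          {within Omega, continuous (partial j (partial i phi))}].

(* The gradient in Omega, prolonged to the boundary by its limits from inside
   Omega. The continuous extension of [grad phi] to [closure Omega] exists iff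
   this function is continuous on [closure Omega], and is then equal to it. *)
Definition grad_cl Omega phi x : 'rV[R]_n :=
  if x \in Omega then grad phi x
  else lim (grad phi y @[y --> within Omega (nbhs x)]).

Definition msection Omega phi x (h : R) : set 'rV[R]_n :=
  [set y | closure Omega y /\
           phi y < phi x + dotp (grad_cl Omega phi x) (y - x) + h].

Record convex_domain Omega : Prop := ConvexDomain {
  cd_nonempty : Omega !=set0 ;
  cd_open : open Omega ;
  cd_convex : convex_set Omega }.

(* [phi] is a total function of which only the values on [closure Omega]
   matter. In [sc_ball], tangency of the ball means that x0 lies on its
   sphere. *)
Record structural_conditions (rho lam Lam : R) Omega phi : Prop :=
  StructuralConditions {
  sc_bounded : Omega `<=` eball 0 rho^-1 ;
  sc_ball : forall x0, frontier Omega x0 ->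
    exists c, eball c rho `<=` Omega /\ enorm (x0 - c) = rho ;
  sc_lipschitz : [lipschitz phi x | x in closure Omega] ;
  sc_C2 : C2_on Omega phi ;
  sc_convex : convex_function (closure Omega) phi ;
  sc_monge_ampere : forall x, Omega x -> lam <= \det (hessian phi x) <= Lam ;
  sc_grad_extends : {within closure Omega, continuous (grad_cl Omega phi)} ;
  sc_quadratic : forall x x0, frontier Omega x -> frontier Omega x0 ->
    rho * enorm (x - x0) ^+ 2
      <= phi x - phi x0 - dotp (grad_cl Omega phi x0) (x - x0)
      <= rho^-1 * enorm (x - x0) ^+ 2 }.

Definition qdist_set Omega phi x y : set R :=
  [set r | 0 < r /\ msection Omega phi y r x /\ msection Omega phi x r y].

Definition qdist Omega phi x y : R := inf (qdist_set Omega phi x y).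

Definition qball Omega phi x (r : R) : set 'rV[R]_n :=
  [set y | closure Omega y /\ qdist Omega phi x y < r].

(* The infimum defining [qdist] is a genuine one: the set is nonempty and
   bounded below by 0. *)
Lemma qdist_set_nonempty Omega phi x y :
  closure Omega x -> closure Omega y -> qdist_set Omega phi x y !=set0.
Proof.
move=> Ox Oy.
pose u := phi x - (phi y + dotp (grad_cl Omega phi y) (x - y)).
pose v := phi y - (phi x + dotp (grad_cl Omega phi x) (y - x)).
have u0 : u <= `|u| by exact: ler_norm.
have v0 : v <= `|v| by exact: ler_norm.
exists (1 + `|u| + `|v|); split; last split; try split=> //.
- by rewrite -addrA ltr_wpDr ?addr_ge0.
- rewrite -ltrBlDl -/u (le_lt_trans u0)// -addrA addrCA ltrDl.
  by rewrite ltr_wpDr.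
- rewrite -ltrBlDl -/v (le_lt_trans v0)// ltrDr.
  by rewrite ltr_wpDr.
Qed.

Lemma qdist_set_has_inf Omega phi x y :
  closure Omega x -> closure Omega y -> has_inf (qdist_set Omega phi x y).
Proof.
move=> Ox Oy; split; first exact: qdist_set_nonempty.
by exists 0 => r [/ltW].
Qed.

Lemma qdist_ge0 Omega phi x y :
  closure Omega x -> closure Omega y -> 0 <= qdist Omega phi x y.
Proof.
move=> Ox Oy; apply: lb_le_inf; first exact: qdist_set_nonempty.
by move=> r [/ltW].
Qed.

End Euclidean.

Definition engulfing_constant (R : realType) (n : nat) (rho lam Lam theta : R)
    : Prop :=
  1 < theta /\
  forall (Omega : set 'rV[R]_n) (phi : 'rV[R]_n -> R),
    convex_domain Omega -> structural_conditions rho lam Lam Omega phi ->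
    forall (x : 'rV[R]_n) (t : R) (y : 'rV[R]_n),
      closure Omega x -> 0 < t -> msection Omega phi x t y ->
      msection Omega phi x t `<=` msection Omega phi y (theta * t).

(* Main.v *)
Require Import Defs.
From mathcomp Require Import all_boot all_order all_algebra.
From mathcomp Require Import all_classical all_reals all_analysis.
From mathcomp Require Import ring lra.
Import Order.TTheory GRing.Theory Num.Theory.
Import numFieldTopology.Exports numFieldNormedType.Exports.
Local Open Scope classical_set_scope.
Local Open Scope ring_scope.

(** The quasi-distance unfolds to a maximum: with the excess
    [e(x,y) = phi y - phi x - grad phi x . (y - x)], a point [y] is in the
    section of height [r] at [x] iff [e(x,y) < r], so [qdist x y] is the largest
    of [e(x,y)], [e(y,x)] and [0].

    Symmetry is immediate. The quasi-triangle inequality and the comparison of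
    quasi-balls with sections are engulfing only: if [x] and [y] lie in one
    section centered at [z] with height [r], then each lies in the section of
    height [theta * r] at the other. This gives the triangle inequality even
    with constant [theta], which is at most [theta ^+ 2] ([qdist_triangle],
    [msection_sub_qball]).

    The analytic content is that [qdist x y = 0] forces [x = y]. If the
    distance vanishes, [phi] does not exceed, at either point, its tangent
    plane at the other one. For two boundary points this contradicts the
    quadratic separation of [phi] from its tangent planes on the boundary,
    unless they coincide. Otherwise one of the points, say [x], is interior, and
    [tangent_touches_once] applies. By convexity [phi] is above its tangent
    plane at [x] on the domain, and below it on the segment from [x] to [y].
    Near [x] on this segment, the slope of the plane is therefore a subgradient
    of [phi], hence equal to its gradient. So [grad phi] is constant in
    the direction [y - x], i.e. the Hessian at [x] kills [y - x]. Its
    determinant is at least [lam > 0], so [y - x = 0].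

    The last argument differentiates [phi] and its first partial derivatives
    in arbitrary directions, which requires that a function with continuous
    partial derivatives has directional derivatives given by its gradient
    ([C1_strict_derive]); it is proved through strict derivatives. *)

(** * Strict directional derivatives *)

(** The base point of the difference quotient moves along with the increment.
    This uniformity is what makes the derivative additive in the direction [v]:
    an ordinary directional derivative at [x] says nothing about the
    increment from [x + h *: v] to [x + h *: v + h *: w]. *)
Definition strict_derive {R : realType} {V : normedModType R} (f : V -> R)
    (x v : V) (c : R) : Prop :=
  forall e, 0 < e -> \forall p \near filter_prod (nbhs x) (nbhs (0 : R)),
    `|f (p.1 + p.2 *: v) - f p.1 - p.2 * c| <= e * `|p.2|.

Lemma line_cvg {R : realType} {V : normedModType R} (x v : V) :
  p.1 + p.2 *: v @[p --> filter_prod (nbhs x) (nbhs (0 : R))] --> x.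
Proof.
rewrite -[x in X in _ --> X]addr0 -[X in (x + X)](scale0r v).
by apply: cvgD; [exact: cvg_fst | apply: cvgZr_tmp; exact: cvg_snd].
Qed.

Lemma strict_derive0 {R : realType} {V : normedModType R} (f : V -> R) (x : V) :
  strict_derive f x 0 0.
Proof.
move=> e e0; near=> p.
by rewrite scaler0 addr0 subrr mulr0 subr0 normr0 mulr_ge0// ltW.
Unshelve. all: by end_near. Qed.

Lemma strict_deriveD {R : realType} {V : normedModType R} (f : V -> R)
    (x v w : V) (c d : R) :
  strict_derive f x v c -> strict_derive f x w d ->
  strict_derive f x (v + w) (c + d).
Proof.
move=> fv fw e e0.
have e2 : 0 < e / 2 by rewrite divr_gt0.
have shift_cvg : (p.1 + p.2 *: v, p.2)
    @[p --> filter_prod (nbhs x) (nbhs (0 : R))]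
    --> filter_prod (nbhs x) (nbhs (0 : R)).
  exact: (@cvg_pair _ _ _ _ _ (nbhs (0 : R)) _ _ _ _ _ (line_cvg x v) cvg_snd).
near=> p.
have H1 : `|f (p.1 + p.2 *: v) - f p.1 - p.2 * c| <= e / 2 * `|p.2|.
  by near: p; exact: fv.
have H2 : `|f (p.1 + p.2 *: v + p.2 *: w) - f (p.1 + p.2 *: v) - p.2 * d|
    <= e / 2 * `|p.2|.
  by near: p; exact: (shift_cvg _ (fw _ e2)).
rewrite scalerDr addrA.
have -> : f (p.1 + p.2 *: v + p.2 *: w) - f p.1 - p.2 * (c + d) =
  (f (p.1 + p.2 *: v + p.2 *: w) - f (p.1 + p.2 *: v) - p.2 * d) +
  (f (p.1 + p.2 *: v) - f p.1 - p.2 * c) by ring.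
rewrite (le_trans (ler_normD _ _))// (splitr e) mulrDl.
exact: lerD.
Unshelve. all: by end_near. Qed.

Lemma strict_deriveZ {R : realType} {V : normedModType R} (f : V -> R)
    (x v : V) (a c : R) :
  strict_derive f x v c -> strict_derive f x (a *: v) (a * c).
Proof.
move=> fv e e0.
have a0 : 0 < `|a| + 1 by rewrite ltr_wpDl.
have mul_cvg : p.2 * a @[p --> filter_prod (nbhs x) (nbhs (0 : R))] --> 0 * a.
  by apply: cvgMr_tmp; exact: cvg_snd.
have scale_cvg : (p.1, p.2 * a) @[p --> filter_prod (nbhs x) (nbhs (0 : R))]
    --> filter_prod (nbhs x) (nbhs (0 : R)).
  apply: (@cvg_pair _ _ _ _ (nbhs x) (nbhs (0 : R)) _ _ _ _ _ cvg_fst).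
  by rewrite mul0r in mul_cvg.
near=> p.
have : `|f (p.1 + (p.2 * a) *: v) - f p.1 - p.2 * a * c|
    <= e / (`|a| + 1) * `|p.2 * a|.
  by near: p; exact: (scale_cvg _ (fv _ (divr_gt0 e0 a0))).
rewrite scalerA mulrA normrM => /le_trans; apply.
rewrite [leLHS]mulrA [leLHS]mulrAC ler_wpM2r// -mulrA ler_piMr//.
  exact: ltW.
by rewrite mulrC ler_pdivrMr// mul1r lerDl.
Unshelve. all: by end_near. Qed.

(** By the mean value theorem, the increment from [y] to [y + h *: v] is [h]
    times ['D_v f] at an intermediate point, and ['D_v f] is continuous at
    [x]. *)
Lemma strict_derive_partial {R : realType} {V : normedModType R} (f : V -> R)
    (x v : V) :
  (\forall y \near x, derivable f y v) -> {for x, continuous ('D_v f)} ->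
  strict_derive f x v ('D_v f x).
Proof.
move=> dfv cfv e e0.
have good : \forall y \near x, derivable f y v /\ `|'D_v f y - 'D_v f x| <= e.
  apply: filterI => //.
  have /cvgrPdist_le/(_ _ e0) := cfv.
  by apply: filterS => y; rewrite distrC.
have [[U W] [/= Ux /nbhs_ballP[r /= r0 rW] UW]] := line_cvg x v _ good.
exists (U, ball (0 : R) r); first by split => //; exact: nbhsx_ballx.
move=> -[y h] [/= Uy]; rewrite -ball_normE/= sub0r normrN => hr.
have seg t : `|t| <= `|h| ->
    derivable f (y + t *: v) v /\ `|'D_v f (y + t *: v) - 'D_v f x| <= e.
  move=> th; apply: (UW (y, t)); split => //=; apply: rW.
  by rewrite -ball_normE/= sub0r normrN (le_lt_trans th).
pose g t := f (y + t *: v).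
have dg t : `|t| <= `|h| -> is_derive t (1 : R) g ('D_v f (y + t *: v)).
  move=> /seg[dft _].
  have E : (fun k : R => k^-1 *: ((g \o shift t) (k *: 1) - g t)) =
      (fun k : R => k^-1 *: ((f \o shift (y + t *: v)) (k *: v) - f (y + t *: v))).
    apply/funext => k; rewrite /g /= [k *: 1]mulr1 scalerDl.
    by congr (_ *: (f _ - _)); rewrite addrCA.
  by split; rewrite /derivable /derive E.
(* The sign of [h] is free, so the mean value theorem is prepared on an
   arbitrary segment within distance [`|h|] of [0]. *)
have segI a b : (forall t, t \in `[a, b] -> `|t| <= `|h|) -> a <= b ->
    exists2 c, `|c| <= `|h| & g b - g a = 'D_v f (y + c *: v) * (b - a).
  move=> abh ab.
  have [||c cab ->] := @MVT_segment _ g (fun t => 'D_v f (y + t *: v)) a b ab.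
  - by move=> t tab; apply/dg/abh/subset_itv_oo_cc.
  - apply: derivable_within_continuous => t tab.
    exact: (@ex_derive _ _ _ _ _ _ _ (dg _ (abh _ tab))).
  by exists c => //; exact: abh.
have [c ch ->] : exists2 c, `|c| <= `|h| &
    f (y + h *: v) - f y = h * 'D_v f (y + c *: v).
  have -> : f y = g 0 by rewrite /g scale0r addr0.
  have [h0|h0] := leP 0 h.
    have [|//|c ch cE] := segI 0 h.
      by move=> t /itvP ht; rewrite !ger0_norm ?ht.
    by exists c => //; rewrite [LHS]cE subr0 mulrC.
  have [||c ch cE] := segI h 0; last 1 first.
  - exists c => //; rewrite -[LHS]opprB [X in - X]cE; ring.
  - move=> t /itvP ht; rewrite !ler0_norm ?ht ?lerN2 ?ht//; exact: ltW.
  - exact: ltW.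
rewrite -mulrBr normrM mulrC ler_wpM2r//.
by have [] := seg c ch.
Qed.

Lemma strict_derive_line {R : realType} {V : normedModType R} (f : V -> R)
    (x v : V) (c e : R) : 0 < e -> strict_derive f x v c ->
  \forall h \near (0 : R), `|f (x + h *: v) - f x - h * c| <= e * `|h|.
Proof.
move=> e0 /(_ _ e0) fe.
have pair_cvg : (x, h) @[h --> (0 : R)] --> filter_prod (nbhs x) (nbhs (0 : R)).
  apply: (@cvg_pair _ _ _ _ (nbhs x) (nbhs (0 : R))); first exact: cvg_cst.
  exact: cvg_id.
exact: (pair_cvg _ fe).
Qed.

(** One-sided comparison: increments for positive [h] suffice to bound the
    derivative, so these lemmas apply along segments starting at [x]. *)
Lemma strict_derive_le {R : realType} {V : normedModType R} (f : V -> R)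
    (x v : V) (a c : R) : strict_derive f x v c ->
  (\forall h \near (0 : R)^'+, f (x + h *: v) <= f x + h * a) -> c <= a.
Proof.
move=> fv fa; apply/ler_addgt0Pr => e e0.
near (0 : R)^'+ => h.
have h0 : 0 < h by near: h; exact: nbhs_right_gt.
have H1 : `|f (x + h *: v) - f x - h * c| <= e * `|h|.
  near: h; apply: cvg_within; exact: strict_derive_line.
have H2 : f (x + h *: v) <= f x + h * a by near: h.
rewrite -(ler_pM2l h0); move: H1; rewrite (gtr0_norm h0) ler_norml => /andP[H1 _].
nra.
Unshelve. all: by end_near. Qed.

Lemma strict_deriveN {R : realType} {V : normedModType R} (f : V -> R)
    (x v : V) (c : R) :
  strict_derive f x v c -> strict_derive (fun y => - f y) x v (- c).
Proof.
move=> fv e e0; apply: filterS (fv e e0) => p.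
by rewrite -normrN; congr (`|_| <= _); ring.
Qed.

Lemma strict_derive_ge {R : realType} {V : normedModType R} (f : V -> R)
    (x v : V) (a c : R) : strict_derive f x v c ->
  (\forall h \near (0 : R)^'+, f x + h * a <= f (x + h *: v)) -> a <= c.
Proof.
move=> fv fa; rewrite -lerN2.
apply: strict_derive_le (strict_deriveN f x v c fv) _.
by apply: filterS fa => h; rewrite mulrN -opprD lerN2.
Qed.

Lemma near_right_line {R : realType} {V : normedModType R} (U : set V)
    (x v : V) : nbhs x U -> \forall h \near (0 : R)^'+, U (x + h *: v).
Proof.
move=> Ux; apply: cvg_within.
have : x + h *: v @[h --> (0 : R)] --> x + 0 *: v.
  by apply: cvgD; [exact: cvg_cst|apply: cvgZr_tmp; exact: cvg_id].
by rewrite scale0r addr0 => /(_ _ Ux).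
Qed.

Section RowVectors.
Context {R : realType} {n : nat}.
Implicit Types (x y z v w a : 'rV[R]_n) (f phi : 'rV[R]_n -> R)
  (Omega : set 'rV[R]_n).

(** * Gradients of functions of several variables *)

Lemma dotpBr x y z : dotp x (y - z) = dotp x y - dotp x z.
Proof.
rewrite /dotp -sumrB; apply: eq_bigr => i _.
by rewrite !mxE mulrBr.
Qed.

Lemma dotpZr x (t : R) y : dotp x (t *: y) = t * dotp x y.
Proof.
rewrite /dotp mulr_sumr; apply: eq_bigr => i _.
by rewrite !mxE mulrCA.
Qed.

Lemma dotp_delta x i : dotp x (delta_mx 0 i) = x 0 i.
Proof.
rewrite /dotp (bigD1 i)//= big1 => [|j ji]; rewrite !mxE eqxx/=.
  by rewrite eqxx mulr1 addr0.
by rewrite (negbTE ji) mulr0.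
Qed.

Lemma enorm_eq0 x : enorm x = 0 -> x = 0.
Proof.
have sq_ge0 i : 0 <= x 0 i * x 0 i by rewrite -expr2 sqr_ge0.
move=> /eqP; rewrite sqrtr_eq0 => x0.
have /eqP : dotp x x = 0 by apply/le_anti; rewrite x0 sumr_ge0.
rewrite psumr_eq0// => /allP xi; apply/rowP => i; rewrite mxE.
have := xi i (mem_index_enum i).
by rewrite /= mulf_eq0 orbb => /eqP.
Qed.

Lemma strict_derive_row f x v :
  (forall i, strict_derive f x (delta_mx 0 i) (partial i f x)) ->
  strict_derive f x v (dotp (grad f x) v).
Proof.
move=> df; rewrite [X in strict_derive _ _ X _]row_sum_delta /dotp.
apply: (big_ind2 (strict_derive f x)).
- exact: strict_derive0.
- by move=> *; exact: strict_deriveD.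
by move=> i _; rewrite mulrC mxE; exact: strict_deriveZ.
Qed.

Lemma C1_strict_derive Omega f x v : open Omega -> Omega x ->
  (forall i y, Omega y -> derivable f y (delta_mx 0 i)) ->
  (forall i, {within Omega, continuous (partial i f)}) ->
  strict_derive f x v (dotp (grad f x) v).
Proof.
move=> oO Ox df cf; apply: strict_derive_row => i; apply: strict_derive_partial.
  by apply: filterS (open_nbhs_nbhs (conj oO Ox)) => y; exact: df.
have := cf i; rewrite continuous_open_subspace// => /(_ x).
by apply; rewrite inE.
Qed.

(** * Convex functions and their tangent planes *)

Lemma convex_function_segment (A : set 'rV[R]_n) f x y (t : R) :
  convex_function A f -> A x -> A y -> 0 <= t <= 1 ->
  f (x + t *: (y - x)) <= f x + t * (f y - f x).
Proof.
move=> cf Ax Ay /andP[t0 t1].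
have := cf (Itv01 t0 t1) y x; rewrite !inE => /(_ Ay Ax).
rewrite [leRHS]/conv/= /conv/=.
have -> : t *: y + unstable.onem t *: x = x + t *: (y - x).
  rewrite /unstable.onem scalerBl scale1r scalerBr; exact: addrCA.
have -> : t *: f y + unstable.onem t *: f x = f x + t * (f y - f x).
  rewrite /unstable.onem /GRing.scale/=; ring.
by [].
Qed.

Lemma convex_above_tangent (A : set 'rV[R]_n) f x w :
  (forall v, strict_derive f x v (dotp (grad f x) v)) ->
  convex_function A f -> A x -> A w -> dotp (grad f x) (w - x) <= f w - f x.
Proof.
move=> df cf Ax Aw; apply: strict_derive_le (df (w - x)) _.
near=> h; apply: convex_function_segment => //.
by apply/andP; split; near: h; [exact: nbhs_right_ge|exact: nbhs_right_le].
Unshelve. all: by end_near. Qed.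

(** A subgradient [a] satisfies [a . v <= grad f z . v] in every direction, and
    the directions [v] and [- v] together give equality. *)
Lemma grad_subgradient (U : set 'rV[R]_n) f z a : nbhs z U ->
  (forall v, strict_derive f z v (dotp (grad f z) v)) ->
  (forall w, U w -> f z + dotp a (w - z) <= f w) -> grad f z = a.
Proof.
move=> Uz df fa.
have dir v : dotp a v <= dotp (grad f z) v.
  apply: strict_derive_ge (df v) _.
  apply: filterS (near_right_line U z v Uz) => h /fa.
  by rewrite addrAC subrr add0r dotpZr.
apply/rowP => i; apply/le_anti.
have := dir (delta_mx 0 i); have := dir (- 1 *: delta_mx 0 i).
by rewrite !dotpZr !dotp_delta !mulN1r lerN2 => -> ->.
Qed.

(** Strict convexity at a point with nondegenerate Hessian, in a form that
    reaches the boundary: only [x] has to be interior. If [phi] touches its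
    tangent plane at [y], the gradient is constant on the segment near [x], so
    [y - x] is in the kernel of the Hessian. *)
Lemma tangent_touches_once Omega phi x y : open Omega -> C2_on Omega phi ->
  convex_function (closure Omega) phi -> Omega x -> closure Omega y ->
  \det (hessian phi x) != 0 ->
  phi y <= phi x + dotp (grad phi x) (y - x) -> x = y.
Proof.
move=> oO [_ C2phi] cphi Ox Oy Hx touch.
have dphi z v : Omega z -> strict_derive phi z v (dotp (grad phi z) v).
  by move=> Oz; apply: (C1_strict_derive Omega) => // i; have [] := C2phi i.
have dpartial i v : strict_derive (partial i phi) x v
    (dotp (grad (partial i phi) x) v).
  by apply: (C1_strict_derive Omega) => // j; have [_ _ /(_ j)[]] := C2phi i.
have clO z : Omega z -> closure Omega z by exact: subset_closure.
have nbO z : Omega z -> nbhs z Omega by move=> Oz; exact: open_nbhs_nbhs.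
set v := y - x.
have nearO := near_right_line Omega x v (nbO x Ox).
(* On the segment, [phi] is below its tangent plane at [x], and everywhere it
   is above; so this plane also supports [phi] at [x + t *: v]. *)
have grad_cst : \forall t \near (0 : R)^'+, grad phi (x + t *: v) = grad phi x.
  near=> t.
  have t0 : 0 <= t by near: t; exact: nbhs_right_ge.
  have t1 : t <= 1 by near: t; exact: nbhs_right_le.
  have Ot : Omega (x + t *: v) by near: t.
  apply: (grad_subgradient Omega) => [|u|w Ow]; [exact: nbO|exact: dphi|].
  have chord : phi (x + t *: v) <= phi x + t * (phi y - phi x).
    by apply: convex_function_segment cphi _ _ _ => //; [exact: clO|rewrite t0].
  have above : dotp (grad phi x) (w - x) <= phi w - phi x.
    apply: convex_above_tangent cphi (clO x Ox) (clO w Ow) => u.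
    exact: dphi.
  rewrite opprD addrA dotpBr dotpZr.
  have : t * (phi y - phi x) <= t * dotp (grad phi x) v.
    by rewrite ler_wpM2l// lerBlDl.
  lra.
(* The [i]-th row of the Hessian is the gradient of [partial i phi], whose
   derivative along [v] vanishes as [partial i phi] is constant along [v]. *)
have Hv : hessian phi x *m v^T = 0.
  apply/colP => i; rewrite !mxE.
  transitivity (dotp (grad (partial i phi) x) v).
    by apply: eq_bigr => j _; rewrite !mxE.
  apply/le_anti/andP; split.
    apply: strict_derive_le (dpartial i v) _; apply: filterS grad_cst => t.
    by move=> /rowP/(_ i); rewrite !mxE => ->; rewrite mulr0 addr0.
  apply: strict_derive_ge (dpartial i v) _; apply: filterS grad_cst => t.
  by move=> /rowP/(_ i); rewrite !mxE => ->; rewrite mulr0 addr0.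
have Hu : hessian phi x \in unitmx by rewrite unitmxE unitfE.
apply/esym/subr0_eq/trmx_inj.
by rewrite -/v -(mulKmx Hu v^T) Hv mulmx0 trmx0.
Unshelve. all: by end_near. Qed.

(** * Sections and the quasi-distance *)

Lemma msection_self Omega phi x (r : R) : closure Omega x -> 0 < r ->
  msection Omega phi x r x.
Proof.
move=> Ox r0; split => //; rewrite subrr -(scale0r 0) dotpZr mul0r addr0.
by rewrite ltrDl.
Qed.

Lemma msection_mono Omega phi x (r s : R) : r <= s ->
  msection Omega phi x r `<=` msection Omega phi x s.
Proof.
by move=> rs y [Oy xy]; split => //; rewrite (lt_le_trans xy)// lerD2l.
Qed.

Lemma qdistC Omega phi x y : qdist Omega phi x y = qdist Omega phi y x.
Proof. by congr inf; apply/seteqP; split => r [? []]. Qed.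

Lemma qdist_le Omega phi x y (r : R) :
  qdist_set Omega phi x y r -> qdist Omega phi x y <= r.
Proof. by apply: ge_inf; exists 0 => s [/ltW]. Qed.

Lemma qdist_lt Omega phi x y (r : R) : closure Omega x -> closure Omega y ->
  qdist Omega phi x y < r -> qdist_set Omega phi x y r.
Proof.
move=> Ox Oy dr.
have [s [s0 [sy sx]] /ltW sr] := inf_lt (qdist_set_nonempty phi Ox Oy) dr.
split; first exact: lt_le_trans sr.
by split; apply: msection_mono sr _ _.
Qed.

Lemma qdist_eq0_touch Omega phi x y : closure Omega x -> closure Omega y ->
  qdist Omega phi x y = 0 ->
  phi y <= phi x + dotp (grad_cl Omega phi x) (y - x).
Proof.
move=> Ox Oy d0; apply/ler_addgt0Pr => e e0.
by have [|_ [_ [_ /ltW]]] := qdist_lt Omega phi x y e Ox Oy; rewrite ?d0.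
Qed.

Definition engulfing (theta : R) Omega phi : Prop :=
  forall x (t : R) y, closure Omega x -> 0 < t -> msection Omega phi x t y ->
    msection Omega phi x t `<=` msection Omega phi y (theta * t).

(** For heights [r > qdist x z] and [s > qdist z y], both [x] and [y] are in the
    section of height [r + s] at [z], and engulfing recenters it at [x] and
    at [y]. *)
Lemma qdist_triangle (theta : R) Omega phi x y z : 0 < theta ->
  engulfing theta Omega phi ->
  closure Omega x -> closure Omega y -> closure Omega z ->
  qdist Omega phi x y <= theta * (qdist Omega phi x z + qdist Omega phi z y).
Proof.
move=> theta0 engulf Ox Oy Oz.
set D := qdist Omega phi x z + qdist Omega phi z y.
(* The infima need not be attained: [2 * theta * d] is the allowed slack [e]. *)
apply/ler_addgt0Pr => e e0.
pose d := e / theta / 2.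
have d0 : 0 < d by rewrite !divr_gt0.
have [r0 [zx _]] : qdist_set Omega phi x z (qdist Omega phi x z + d).
  by apply: qdist_lt => //; rewrite ltrDl.
have [s0 [_ zy]] : qdist_set Omega phi z y (qdist Omega phi z y + d).
  by apply: qdist_lt => //; rewrite ltrDl.
set r := qdist Omega phi x z + d in r0 zx.
set s := qdist Omega phi z y + d in s0 zy.
have zx' : msection Omega phi z (r + s) x.
  by apply: msection_mono zx; rewrite lerDl ltW.
have zy' : msection Omega phi z (r + s) y.
  by apply: msection_mono zy; rewrite lerDr ltW.
have rs0 : 0 < r + s by rewrite addr_gt0.
have -> : theta * D + e = theta * (r + s).
  by rewrite /r /s /D /d; field; rewrite gt_eqF.
apply: qdist_le; split; first by rewrite mulr_gt0.
by split; [exact: (engulf z _ y)|exact: (engulf z _ x)].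
Qed.

(** The center [x] belongs to its own section, so engulfing puts it in the
    section of height [theta * t] at [y]. *)
Lemma msection_sub_qball (theta : R) Omega phi x (t r : R) : 1 <= theta ->
  engulfing theta Omega phi -> closure Omega x -> 0 < t -> theta * t < r ->
  msection Omega phi x t `<=` qball Omega phi x r.
Proof.
move=> theta1 engulf Ox t0 tr y xy; split; first exact: xy.1.
apply: le_lt_trans tr; apply: qdist_le; split.
  by rewrite mulr_gt0// (lt_le_trans _ theta1).
split; last by apply: msection_mono xy; rewrite ler_peMl// ltW.
exact: engulf xy _ (msection_self _ _ _ _ Ox t0).
Qed.

End RowVectors.

Theorem theorem6p2 (R : realType) (n : nat) (hn : (0 < n)%N)
    (rho lam Lam theta : R)
    (hrho : 0 < rho) (hlam : 0 < lam) (hLam : 0 < Lam)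
    (htheta : engulfing_constant n rho lam Lam theta)
    (Omega : set 'rV[R]_n) (phi : 'rV[R]_n -> R)
    (hOmega : convex_domain Omega)
    (hphi : structural_conditions rho lam Lam Omega phi) :
  [/\ forall x y : 'rV[R]_n, closure Omega x -> closure Omega y ->
        qdist Omega phi x y = qdist Omega phi y x,
      forall x y : 'rV[R]_n, closure Omega x -> closure Omega y ->
        (qdist Omega phi x y = 0 <-> x = y),
      forall x y z : 'rV[R]_n, closure Omega x -> closure Omega y -> closure Omega z ->
        qdist Omega phi x y
          <= theta ^+ 2 * (qdist Omega phi x z + qdist Omega phi z y)
    & forall (x : 'rV[R]_n) (r : R), closure Omega x -> 0 < r ->
        msection Omega phi x (r / (2 * theta ^+ 2)) `<=` qball Omega phi x r /\
        qball Omega phi x r `<=` msection Omega phi x r].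
Proof.
have [theta1 /(_ Omega phi hOmega hphi) engulf] := htheta.
have theta0 : 0 < theta by exact: lt_trans theta1.
have theta_le2 : theta <= theta ^+ 2 by rewrite expr2 ler_peMr// ltW.
have Oopen := cd_open hOmega.
have frontierO x : closure Omega x -> ~ Omega x -> frontier Omega x.
  by move=> Ox nOx; split => // /interior_subset.
have touch_inside x y : Omega x -> closure Omega y -> qdist Omega phi x y = 0 ->
    x = y.
  move=> Ox Oy d0.
  have := qdist_eq0_touch Omega phi x y (subset_closure Ox) Oy d0.
  rewrite /grad_cl mem_set//; apply: (tangent_touches_once Omega) => //.
  - exact: sc_C2 hphi.
  - exact: sc_convex hphi.
  have /andP[+ _] := sc_monge_ampere hphi Ox.
  by move=> /(lt_le_trans hlam) /lt0r_neq0.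
split.
- by move=> x y _ _; exact: qdistC.
- move=> x y Ox Oy; split => [d0|<-]; last first.
    apply/le_anti; rewrite qdist_ge0// andbT; apply/ler_addgt0Pr => e e0.
    by rewrite add0r; apply: qdist_le; split => //; split; exact: msection_self.
  (* Two boundary points are separated by the quadratic growth on the boundary;
     an interior point can be taken first, by symmetry. *)
  have [xO|xO] := pselect (Omega x); first exact: touch_inside.
  have [yO|yO] := pselect (Omega y).
    by apply/esym/touch_inside => //; rewrite qdistC.
  have /andP[le_phi _] :=
    sc_quadratic hphi (frontierO y Oy yO) (frontierO x Ox xO).
  have touch := qdist_eq0_touch Omega phi x y Ox Oy d0.
  have : rho * enorm (y - x) ^+ 2 <= 0.
    by rewrite (le_trans le_phi)// -addrA -opprD subr_le0.
  rewrite pmulr_rle0// => yx; apply/esym/subr0_eq/enorm_eq0/eqP.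
  by rewrite -sqrf_eq0 eq_le yx sqr_ge0.
- move=> x y z Ox Oy Oz.
  apply: le_trans (qdist_triangle _ _ _ _ _ _ theta0 engulf Ox Oy Oz) _.
  by rewrite ler_wpM2r// addr_ge0// qdist_ge0.
move=> x r Ox r0; split => y; last first.
  by move=> [Oy /(qdist_lt _ _ _ _ _ Ox Oy)[_ []]].
have t0 : 0 < r / (2 * theta ^+ 2) by rewrite divr_gt0// mulr_gt0// exprn_gt0.
apply: (msection_sub_qball _ _ _ _ _ _ (ltW theta1) engulf Ox t0).
rewrite mulrA ltr_pdivrMr ?mulr_gt0 ?exprn_gt0//.
rewrite mulrC ltr_pM2l// (le_lt_trans theta_le2)// ltr_pMl ?exprn_gt0//.
by rewrite ltr1n.
Qed.
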